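(* Let $S,T$ be disjoint finite sets, $\ell\le|T|$ an integer, and $f_V=(f_S,f_T)$, $g_V=(g_S,g_T)$ integer-valued functions on $V=S\cup T$ with $0\le f_V\le g_V$. (A) There is a simple bipartite graph $G'=(S,T;E')$ with matching number $\nu(G')\ge\ell$, $d_{G'}(s)\le g_S(s)$ $(s\in S)$ and $d_{G'}(t)\ge f_T(t)$ $(t\in T)$ if and only if $$\widetilde f_T(Y)-|X||Y|+(\ell-|X|-|Y|)^+\le\widetilde g_S(S-X)\quad\text{whenever }X\subseteq S,\ Y\subseteq T.\quad(1)$$ Moreover, (1) holds if the inequality is required only when $X$ consists of $i$ elements of $S$ with the largest values of $g_S$ and $Y$ consists of $j$ elements of $T$ with the largest values of $f_T$ $(i=0,1,\dots,|S|,\ j=0,1,\dots,|T|)$. (B) There is a simple bipartite graph $G''=(S,T;E'')$ with $\nu(G'')\ge\ell$, $d_{G''}(s)\ge f_S(s)$ $(s\in S)$ and $d_{G''}(t)\le g_T(t)$ $(t\in T)$ if and only if $$\widetilde f_S(X)-|X||Y|+(\ell-|X|-|Y|)^+\le\widetilde g_T(T-Y)\quad\text{whenever }X\subseteq S,\ Y\subseteq T.\quad(2)$$ Moreover, (2) holds if the inequality is required only when $X$ consists of $i$ elements of $S$ with the largest values of $f_S$ and $Y$ consists of $j$ elements of $T$ with the largest values of $g_T$ $(i=0,\dots,|S|,\ j=0,\dots,|T|)$. (AB) There is a simple bipartite graph $G=(S,T;E)$ with $\nu(G)\ge\ell$ and $f_V(v)\le d_G(v)\le g_V(v)$ for all $v\in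 V$ if and only if both $G'$ and $G''$ exist (that is, both (1) and (2) hold).
   Context: A bipartite graph is simple if it has no parallel edges; $\nu(G)$ is the maximum size of a matching; $d_G(v)$ is the degree. $\widetilde h(X)=\sum_{v\in X}h(v)$; $x^+=\max\{x,0\}$.
   Formalization: In (B), the implication from (2) to the existence of G'' is proved under the added assumption ℓ ≤ |S|; without it the claim fails, e.g. for |S|=1, |T|=2, ℓ=2, f=0, g=2, where (2) holds but ν(G'') ≤ 1. *)

(* Defs.v *)
From mathcomp Require Import all_boot all_order all_algebra.

Set Implicit Arguments.
Unset Strict Implicit.
Unset Printing Implicit Defensive.

Import Order.TTheory GRing.Theory Num.Theory.
Local Open Scope ring_scope.

(* A simple bipartite graph (S, T; E) is given by its edge set
   E : {set S * T}.  The disjoint union of the two colour classes, i.e. the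
   vertex set V, is the sum type S + T. *)

Definition deg (S T : finType) (E : {set S * T}) (v : S + T) : nat :=
  match v with
  | inl s => #|[set e in E | e.1 == s]|
  | inr t => #|[set e in E | e.2 == t]|
  end.

Definition is_matching (S T : finType) (E M : {set S * T}) : bool :=
  (M \subset E) &&
  [forall e in M, forall e' in M,
     (e.1 == e'.1) || (e.2 == e'.2) ==> (e == e')].

Definition nu (S T : finType) (E : {set S * T}) : nat :=
  \max_(M : {set S * T} | is_matching E M) #|M|.

Definition tilde (U : finType) (h : U -> int) (X : {set U}) : int :=
  \sum_(v in X) h v.

Definition pos_part (x : int) : int := Num.max x 0.

Definition ineq1 (S T : finType) (l : int) (f g : S + T -> int)
    (X : {set S}) (Y : {set T}) : Prop :=
  tilde (f \o inr) Y - #|X|%:Z * #|Y|%:Z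
    + pos_part (l - #|X|%:Z - #|Y|%:Z)
  <= tilde (g \o inl) (~: X).

Definition ineq2 (S T : finType) (l : int) (f g : S + T -> int)
    (X : {set S}) (Y : {set T}) : Prop :=
  tilde (f \o inl) X - #|X|%:Z * #|Y|%:Z
    + pos_part (l - #|X|%:Z - #|Y|%:Z)
  <= tilde (g \o inr) (~: Y).

(* X consists of i elements with the largest values of h; because of ties
   there may be several such sets X. *)
Definition largest (U : finType) (h : U -> int) (i : nat) (X : {set U}) : Prop :=
  #|X| = i /\ (forall x y : U, x \in X -> y \notin X -> h y <= h x).

Definition graph_A (S T : finType) (l : int) (f g : S + T -> int)
    (E : {set S * T}) : Prop :=
  [/\ l <= (nu E)%:Z,
      forall s : S, (deg E (inl s))%:Z <= g (inl s)
    & forall t : T, f (inr t) <= (deg E (inr t))%:Z].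

Definition graph_B (S T : finType) (l : int) (f g : S + T -> int)
    (E : {set S * T}) : Prop :=
  [/\ l <= (nu E)%:Z,
      forall s : S, f (inl s) <= (deg E (inl s))%:Z
    & forall t : T, (deg E (inr t))%:Z <= g (inr t)].

Definition graph_AB (S T : finType) (l : int) (f g : S + T -> int)
    (E : {set S * T}) : Prop :=
  l <= (nu E)%:Z /\ (forall v : S + T, f v <= (deg E v)%:Z <= g v).

(* Main.v *)
(* The conditions (1) and (2) can be uncrossed against each other: a set pair
   tight for (1) and one tight for (2) yield, by taking unions and
   intersections, a pair of inequalities of smaller total slack. Hence as long
   as f(v) < g(v), either f(v) can be raised or g(v) lowered, until f = g = d
   is an exact degree prescription. Let M match the l largest prescribed
   degrees on S with the l largest on T in reverse order; then exactly
   (l - i - j)^+ edges of M avoid the i largest vertices of S and the j largest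
   of T. Therefore (1) gives the Hoffman-type cut condition for a graph of
   degrees d containing M, first for upper level sets and then, by minimising
   over each side in turn, for all set pairs. The graph is found by fixing one
   edge at a time, again by uncrossing. Parts (A) and (B) are the cases
   of (AB) in which the unwanted bounds are relaxed to f = 0 and to g = f + 1. *)

Require Import Defs.
From mathcomp Require Import all_boot all_order all_algebra.
From mathcomp Require Import zify ring.
Set Implicit Arguments.
Unset Strict Implicit.
Unset Printing Implicit Defensive.
Import Order.TTheory GRing.Theory Num.Theory.
Local Open Scope ring_scope.

(** * Uncrossing the cardinality term *)

(* As n - x - y is truncated, rho is |X||Y| - (l - |X| - |Y|)^+ for
   n = max l 0, |X| = x and |Y| = y. *)
Definition rho (n x y : nat) : int := (x * y)%:Z - (n - x - y)%:Z.

(** [c] and [e] are sizes of intersections, the other letters sizes of differences. The products on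
    the right exceed those on the left by exactly [p * q + p' * q'], which pays for any loss in the
    truncated terms. *)
Lemma rho_uncross (n c e p p' q q' : nat) :
  rho n (c + p + p') e + rho n c (e + q + q')
    <= rho n (c + p) (e + q) + rho n (c + p') (e + q').
Proof.
(* A product of positive integers bounds both factors; given this, the goal is linear in [pq] and
   [pq']. *)
have le_mul (a b : nat) : (0 < a -> b <= a * b)%N by case: a => // a; lia.
have h1 := le_mul p q; have h2 := le_mul q p.
have h3 := le_mul p' q'; have h4 := le_mul q' p'.
rewrite (mulnC q) in h2; rewrite (mulnC q') in h4.
rewrite /rho !mulnDl !mulnDr.
set pq := (p * q)%N in h1 h2 *; set pq' := (p' * q')%N in h3 h4 *.
by lia.
Qed.

Lemma Posz_sum (I : finType) (P : pred I) (F : I -> nat) :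
  (\sum_(i | P i) F i)%N%:Z = \sum_(i | P i) (F i)%:Z.
Proof. exact: (big_morph Posz PoszD (erefl _)). Qed.

(** * Weights, sets of largest values, upper level sets *)

Section Cards.
Variable U : finType.
Implicit Types X Y : {set U}.

Lemma cardsUI_diff X1 X2 :
  [/\ #|X1| = (#|X1 :&: X2| + #|X1 :\: X2|)%N,
      #|X2| = (#|X1 :&: X2| + #|X2 :\: X1|)%N
    & #|X1 :|: X2| = (#|X1 :&: X2| + #|X1 :\: X2| + #|X2 :\: X1|)%N].
Proof.
have h1 := cardsID X2 X1; have h2 := cardsID X1 X2.
rewrite setIC in h2; have h3 := cardsUI X1 X2.
split; lia.
Qed.

Lemma tildeE (h : U -> int) X : tilde h X = \sum_u (u \in X)%:Z * h u.
Proof.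
rewrite /tilde big_mkcond; apply: eq_bigr => u _.
by case: (u \in X); rewrite ?mul1r ?mul0r.
Qed.

(** Holds element by element. The term in [g - f] is what uncrossing gains on [X2 :\: X1]. *)
Lemma tilde_uncross (f g : U -> int) X1 X2 :
  tilde f X2 - tilde g (~: X1) + tilde (fun u => g u - f u) (X2 :\: X1)
  = tilde f (X1 :&: X2) - tilde g (~: (X1 :|: X2)).
Proof.
rewrite !tildeE -!sumrN -!big_split /=; apply: eq_bigr => u _; rewrite !inE.
by case: (u \in X1); case: (u \in X2) => /=; ring.
Qed.

Lemma tilde_ge (h : U -> int) X u :
  (forall v, 0 <= h v) -> u \in X -> h u <= tilde h X.
Proof.
move=> h0 uX; rewrite /tilde (bigD1 u) //= lerDl.
by apply: sumr_ge0.
Qed.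

Lemma tilde_ge0 (h : U -> int) X : (forall v, 0 <= h v) -> 0 <= tilde h X.
Proof. by move=> h0; apply: sumr_ge0. Qed.

Lemma tildeC (h : U -> int) X : tilde h (~: X) = tilde h setT - tilde h X.
Proof.
rewrite !tildeE -sumrN -big_split /=; apply: eq_bigr => u _; rewrite !inE.
by case: (u \in X) => /=; ring.
Qed.

Lemma tilde_const (c : int) X : tilde (fun=> c) X = #|X|%:Z * c.
Proof. by rewrite /tilde sumr_const -mulr_natl natz. Qed.

(** Take a heaviest set of the same size: swapping a member for a larger outside element would make
    it heavier. *)
Lemma largest_exists (h : U -> int) X :
  exists X', [/\ largest h #|X| X', #|X'| = #|X| & tilde h X <= tilde h X'].
Proof.
have [/= X' /eqP cX' maxX'] :=
  @arg_maxP _ _ _ X (fun Z : {set U} => #|Z| == #|X|) (tilde h) (eqxx _).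
exists X'; split=> //; last exact: maxX'.
split=> // x y xX' yX'.
have nyx : y != x by apply: contraNneq yX' => ->.
have := maxX' (y |: (X' :\ x)).
rewrite cardsU1 !inE (negbTE yX') andbF /= (cardsD1 x X') xX' in cX' *.
move=> /(_ (introT eqP cX')).
rewrite /tilde (big_setD1 x xX') /= big_setU1 ?inE ?(negbTE yX') ?andbF //=.
by rewrite lerD2r.
Qed.

Definition above (h : U -> int) c : {set U} := [set u | c < h u].

Lemma in_above (h : U -> int) c u : (u \in above h c) = (c < h u).
Proof. by rewrite inE. Qed.

(** Listing the elements by decreasing [h] makes every upper level set an initial segment. *)
Lemma enum_decreasing (h : U -> int) :
  exists2 e : 'I_#|U| -> U, injective e &
    forall (c : int) i, (c < h (e i)) = (i < #|above h c|)%N.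
Proof.
(* Ties are broken by [enum_rank], so the order is total and the number [r] of predecessors is
   injective. *)
pose before v u := (h u < h v) || (h u == h v) && (enum_rank v < enum_rank u)%N.
pose r u := #|[set v | before v u]|.
have r_mono u v : before u v -> (r u < r v)%N.
  move=> buv; apply: proper_card; apply/properP; split.
    apply/subsetP=> w; rewrite !inE; move: buv; rewrite /before.
    by lia.
  by exists u; rewrite !inE // /before ltxx ltnn andbF.
have rP u : (r u < #|U|)%N.
  rewrite -cardsT; apply: proper_card; apply/properP; split.
    exact: subsetT.
  by exists u; rewrite !inE // /before ltxx ltnn andbF.
have r_inj : injective (fun u => Ordinal (rP u)).
  move=> u v [ruv]; apply: enum_rank_inj; apply: val_inj => /=.
  have := @r_mono u v; have := @r_mono v u; rewrite ruv ltnn /before.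
  case: (ltgtP (h u) (h v)) => _ /= h1 h2; [by move: (h1 isT)|by move: (h2 isT)|].
  by case: ltngtP h1 h2 => // _ h1 h2; [move: (h1 isT)|move: (h2 isT)].
have [e rK eK] := inj_card_bij r_inj (eq_leq (card_ord _)).
exists e; first exact: can_inj eK.
move=> c i; have -> : (i : nat) = r (e i) by rewrite -[in LHS](eK i).
case: ltP => hc; apply/esym.
  apply: proper_card; apply/properP; split.
    by apply/subsetP=> w; rewrite !inE /before; lia.
  by exists (e i); rewrite !inE // /before ltxx ltnn andbF.
apply/negbTE; rewrite -leqNgt; apply: subset_leq_card.
by apply/subsetP=> w; rewrite !inE /before; lia.
Qed.

End Cards.

(** * Hoffman-type existence of edge sets with given degrees *)

Section Edges.
Variables S T : finType.
Implicit Types (X : {set S}) (Y : {set T}) (A L U E M : {set S * T}).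
Implicit Types (d f g : S + T -> int).

Definition edges A X Y : nat := #|A :&: setX X Y|.

Lemma edgesE A X Y :
  (edges A X Y)%:Z = \sum_e [&& e \in A, e.1 \in X & e.2 \in Y]%:Z.
Proof.
rewrite /edges -sum1_card big_mkcond Posz_sum /=; apply: eq_bigr => -[s t] _.
by rewrite !inE /=; case: ifP.
Qed.

Lemma edgesID1 A e X Y : e \in A ->
  edges A X Y = ((e.1 \in X) && (e.2 \in Y) + edges (A :\ e) X Y)%N.
Proof.
case: e => s t eA; rewrite /edges (cardsD1 (s, t)) !inE eA /=.
by congr (_ + #|pred_of_set _|)%N; apply/setP=> x; rewrite !inE andbA.
Qed.

(* By Hoffman's circulation theorem this is nonnegative for all X and Y exactly
   when some E with L <= E <= U has degrees d, provided d(S) = d(T). *)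
Definition flow_slack d L U X Y : int :=
  tilde (d \o inl) (~: X) + (edges U X Y)%:Z
  - tilde (d \o inr) Y - (edges L (~: X) (~: Y))%:Z.

(** The weights are modular and the edge terms compare edge by edge. Strictness comes from [e],
    counted in [edges U X1 Y1] but in no term of the uncrossed pairs. *)
Lemma flow_slack_uncross d L U X1 X2 Y1 Y2 e :
  L \subset U -> e \in U :\: L -> e.1 \in X1 :\: X2 -> e.2 \in Y1 :\: Y2 ->
  flow_slack d L U (X1 :|: X2) (Y1 :&: Y2)
    + flow_slack d L U (X1 :&: X2) (Y1 :|: Y2)
  < flow_slack d L U X1 Y1 + flow_slack d L U X2 Y2.
Proof.
move=> sLU; rewrite !inE => /andP[eL eU] /andP[eX2 eX1] /andP[eY2 eY1].
have modS : tilde (d \o inl) (~: (X1 :|: X2)) + tilde (d \o inl) (~: (X1 :&: X2))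
    = tilde (d \o inl) (~: X1) + tilde (d \o inl) (~: X2).
  rewrite !tildeE -!big_split; apply: eq_bigr => s _ /=; rewrite !inE.
  by case: (s \in X1); case: (s \in X2) => /=; ring.
have modT : tilde (d \o inr) (Y1 :&: Y2) + tilde (d \o inr) (Y1 :|: Y2)
    = tilde (d \o inr) Y1 + tilde (d \o inr) Y2.
  rewrite !tildeE -!big_split; apply: eq_bigr => s _ /=; rewrite !inE.
  by case: (s \in Y1); case: (s \in Y2) => /=; ring.
suff : (edges U (X1 :|: X2) (Y1 :&: Y2))%:Z + (edges U (X1 :&: X2) (Y1 :|: Y2))%:Z
       + ((edges L (~: X1) (~: Y1))%:Z + (edges L (~: X2) (~: Y2))%:Z)
    < (edges U X1 Y1)%:Z + (edges U X2 Y2)%:Z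
       + ((edges L (~: (X1 :|: X2)) (~: (Y1 :&: Y2)))%:Z
          + (edges L (~: (X1 :&: X2)) (~: (Y1 :|: Y2)))%:Z).
  by rewrite /flow_slack; lia.
rewrite !edgesE -!big_split /= (bigD1 e) //= [X in _ < X](bigD1 e) //=.
apply: ltr_leD.
  rewrite !inE eU (negbTE eL) eX1 eY1 (negbTE eX2) (negbTE eY2) /=; lia.
apply: ler_sum => -[s t] _; rewrite !inE /=.
case: (boolP ((s, t) \in L)) => [/(subsetP sLU)->|_]; last case: (_ \in U);
by case: (s \in X1); case: (s \in X2); case: (t \in Y1); case: (t \in Y2).
Qed.

(** Induction on the number of undecided edges: [e] is either deleted from [U] or added to [L]. If
    both choices failed, uncrossing the two violating pairs would produce a negative slack for [L]
    and [U]. *)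
Lemma flow_exists d L U : L \subset U ->
  (forall X Y, 0 <= flow_slack d L U X Y) ->
  exists2 E : {set S * T}, L \subset E & forall X Y, 0 <= flow_slack d E E X Y.
Proof.
have [k] := ubnP #|U :\: L|; elim: k => // k IHk in L U * => leUL sLU posLU.
have [UL0|[e eUL]] := set_0Vmem (U :\: L).
  exists L => // X Y; suff {2}-> : L = U by [].
  by apply/eqP; rewrite eqEsubset sLU -setD_eq0 UL0 eqxx.
have /andP[eL eU] : (e \notin L) && (e \in U) by move: eUL; rewrite inE.
have eUL1 : (#|(U :\: L) :\ e| < k)%N.
  by move: leUL; rewrite (cardsD1 e) eUL; lia.
have [/forallP low|] :=
    boolP [forall X, forall Y, 0 <= flow_slack d L (U :\ e) X Y].
  apply: (IHk L (U :\ e)) => [||X Y].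
  - suff -> : U :\ e :\: L = (U :\: L) :\ e by [].
    by apply/setP=> x; rewrite !inE andbCA.
  - by rewrite subsetD1 sLU.
  - exact: (forallP (low X)).
rewrite negb_forall => /existsP[X1]; rewrite negb_forall => /existsP[Y1 neg1].
have [/forallP up|] :=
    boolP [forall X, forall Y, 0 <= flow_slack d (e |: L) U X Y].
  have [|||E sLE posE] := IHk (e |: L) U.
  - suff -> : U :\: (e |: L) = (U :\: L) :\ e by [].
    by apply/setP=> x; rewrite !inE negb_or andbA.
  - by rewrite subUset sub1set eU.
  - by move=> X Y; apply: (forallP (up X)).
  by exists E => //; apply: subset_trans sLE; apply: subsetUr.
rewrite negb_forall => /existsP[X2]; rewrite negb_forall => /existsP[Y2 neg2].
exfalso.
have pos1 := posLU X1 Y1; have pos2 := posLU X2 Y2.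
move: neg1 neg2; rewrite -!ltNge.
rewrite /flow_slack (edgesID1 _ _ (setU11 e L)) setU1K // => neg1 neg2.
rewrite /flow_slack in pos1 pos2.
have eU1 := edgesID1 X1 Y1 eU.
(* Deleting [e] lowers a slack only if [e] joins [X1] to [Y1], adding it only if [e] joins the two
   complements, and then by one. So both old slacks are zero and [e] lies as uncrossing requires. *)
have [eX1 eY1] : e.1 \in X1 /\ e.2 \in Y1.
  apply/andP; case: andP eU1 => //= _ eU1; exfalso; lia.
have [eX2 eY2] : e.1 \notin X2 /\ e.2 \notin Y2.
  apply/andP; move: neg2; rewrite !in_setC.
  by case: (_ && _) => //= neg2; exfalso; lia.
have := @flow_slack_uncross d L U X1 X2 Y1 Y2 e sLU eUL.
rewrite !inE eX1 eX2 eY1 eY2 => /(_ isT isT).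
have := posLU (X1 :|: X2) (Y1 :&: Y2); have := posLU (X1 :&: X2) (Y1 :|: Y2).
move: neg1 neg2; rewrite eX1 eY1 in eU1; rewrite !inE eX2 eY2 /=.
rewrite /flow_slack; lia.
Qed.

Lemma deg_inlE A s : deg A (inl s) = edges A [set s] setT.
Proof. by apply: eq_card => -[x y]; rewrite !inE andbT. Qed.

Lemma deg_inrE A t : deg A (inr t) = edges A setT [set t].
Proof. by apply: eq_card => -[x y]; rewrite !inE. Qed.

Lemma edges0l A Y : edges A set0 Y = 0%N.
Proof. by apply/eqP; rewrite cards_eq0; apply/eqP/setP=> e; rewrite !inE andbF. Qed.

Lemma edges0r A X : edges A X set0 = 0%N.
Proof. by apply/eqP; rewrite cards_eq0; apply/eqP/setP=> e; rewrite !inE !andbF. Qed.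

Lemma tilde0 (V : finType) (h : V -> int) : tilde h set0 = 0.
Proof. exact: big_set0. Qed.

Lemma tilde1 (V : finType) (h : V -> int) v : tilde h [set v] = h v.
Proof. exact: big_set1. Qed.

(** A singleton paired with the whole other side bounds the degree from below; its complement paired
    with the empty set bounds it from above. On the [T] side the pairs are chosen likewise. *)
Lemma flow_slack_deg d E :
  tilde (d \o inl) setT = tilde (d \o inr) setT ->
  (forall X Y, 0 <= flow_slack d E E X Y) ->
  forall v, (deg E v)%:Z = d v.
Proof.
move=> dST pos [s|t].
- have := pos [set s] setT; have := pos (~: [set s]) set0.
  rewrite /flow_slack deg_inlE setCK setC0 setCT edges0r tilde0 tilde1.
  by rewrite tildeC tilde1 /=; lia.
- have := pos setT [set t]; have := pos set0 (~: [set t]).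
  rewrite /flow_slack deg_inrE setCK setC0 setCT edges0l tilde0 tilde1.
  by rewrite tildeC tilde1 /=; lia.
Qed.

(** * Edge counts between vertex sets, and matchings *)

Lemma edges_suml A X Y : edges A X Y = (\sum_(s in X) edges A [set s] Y)%N.
Proof.
apply/eqP; rewrite -eqz_nat edgesE Posz_sum; apply/eqP.
under [RHS]eq_bigr => s _ do rewrite edgesE.
rewrite exchange_big /=; apply: eq_bigr => -[s t] _ /=.
rewrite big_mkcond (bigD1 s) //= big1 => [|s' /negbTE ns].
  by rewrite !inE eqxx addr0; case: (s \in X); rewrite ?andbF.
by rewrite !inE eq_sym ns andbF; case: ifP.
Qed.

Lemma edges_sumr A X Y : edges A X Y = (\sum_(t in Y) edges A X [set t])%N.
Proof.
apply/eqP; rewrite -eqz_nat edgesE Posz_sum; apply/eqP.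
under [RHS]eq_bigr => s _ do rewrite edgesE.
rewrite exchange_big /=; apply: eq_bigr => -[s t] _ /=.
rewrite big_mkcond (bigD1 t) //= big1 => [|t' /negbTE nt].
  by rewrite !inE eqxx addr0 andbT; case: (t \in Y); rewrite ?andbF ?andbT.
by rewrite !inE eq_sym nt !andbF; case: ifP.
Qed.

Lemma edges_splitl A X Y : edges A setT Y = (edges A X Y + edges A (~: X) Y)%N.
Proof.
rewrite /edges -(cardsID (setX X setT)).
by congr addn; apply: eq_card => -[s t];
  rewrite !inE; case: (s \in X); rewrite ?andbT ?andbF.
Qed.

Lemma edges_splitr A X Y : edges A X setT = (edges A X Y + edges A X (~: Y))%N.
Proof.
rewrite /edges -(cardsID (setX setT Y)).
by congr addn; apply: eq_card => -[s t];
  rewrite !inE; case: (t \in Y); rewrite ?andbT ?andbF.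
Qed.

Lemma edges_le A X Y : (edges A X Y <= #|X| * #|Y|)%N.
Proof. by rewrite -cardsX; apply/subset_leq_card/subsetIr. Qed.

Lemma edges_subset A E X Y : A \subset E -> (edges A X Y <= edges E X Y)%N.
Proof. by move=> sAE; apply/subset_leq_card/setSI. Qed.

Lemma edges_setT X Y : edges setT X Y = (#|X| * #|Y|)%N.
Proof. by rewrite /edges setTI cardsX. Qed.

Lemma matching_inj E M e e' : is_matching E M -> e \in M -> e' \in M ->
  (e.1 == e'.1) || (e.2 == e'.2) -> e = e'.
Proof.
move=> /andP[_ /forall_inP mM] eM e'M ee'.
by have /forall_inP/(_ _ e'M)/implyP/(_ ee')/eqP := mM _ eM.
Qed.

Lemma matching1l E M s Y : is_matching E M -> (edges M [set s] Y <= 1)%N.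
Proof.
move=> mM; apply/card_le1_eqP => e e'; rewrite !inE.
move=> /andP[eM /andP[/eqP es _]] /andP[e'M /andP[/eqP e's _]].
by apply: (matching_inj mM) => //; rewrite es e's eqxx.
Qed.

Lemma matching1r E M X t : is_matching E M -> (edges M X [set t] <= 1)%N.
Proof.
move=> mM; apply/card_le1_eqP => e e'; rewrite !inE.
move=> /andP[eM /andP[_ /eqP et]] /andP[e'M /andP[_ /eqP e't]].
by apply: (matching_inj mM) => //; rewrite et e't eqxx orbT.
Qed.

(** Each vertex of [X] or [Y] carries at most one edge of [M]; the other edges join the
    complements. *)
Lemma matching_cover E M X Y : is_matching E M ->
  (#|M| <= #|X| + #|Y| + edges M (~: X) (~: Y))%N.
Proof.
move=> mM.
have -> : #|M| = edges M setT setT.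
  by apply: eq_card => -[s t]; rewrite !inE !andbT.
rewrite (edges_splitl M X) (edges_splitr M (~: X) Y).
have leX : (edges M X setT <= #|X|)%N.
  by rewrite edges_suml -sum1_card; apply: leq_sum => s _; apply: matching1l mM.
have leY : (edges M (~: X) Y <= #|Y|)%N.
  by rewrite edges_sumr -sum1_card; apply: leq_sum => t _; apply: matching1r mM.
lia.
Qed.

Lemma nu_attained E : exists2 M, is_matching E M & #|M| = nu E.
Proof.
have m0 : is_matching E set0.
  by rewrite /is_matching sub0set; apply/forall_inP => e; rewrite inE.
have [|M mM eM] := @eq_bigmax_cond _ (is_matching E) (fun M : {set S * T} => #|M|).
  by apply/card_gt0P; exists (set0 : {set S * T}).
by exists M; last exact/esym/eM.
Qed.

(** * Slacks of the two conditions and reduction to exact degrees *)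

(** Right side minus left side of [ineq1], with the positive part of [l] as the natural number
    [n]. *)
Definition slackA n f g X Y : int :=
  tilde (g \o inl) (~: X) + rho n #|X| #|Y| - tilde (f \o inr) Y.

Definition slackB n f g X Y : int :=
  tilde (g \o inr) (~: Y) + rho n #|X| #|Y| - tilde (f \o inl) X.

Lemma ineq1E l f g X Y :
  ineq1 l f g X Y <-> 0 <= slackA `|Num.max l 0| f g X Y.
Proof. by rewrite /ineq1 /slackA /rho /pos_part; split; lia. Qed.

Lemma ineq2E l f g X Y :
  ineq2 l f g X Y <-> 0 <= slackB `|Num.max l 0| f g X Y.
Proof. by rewrite /ineq2 /slackB /rho /pos_part; split; lia. Qed.

(** On each colour class one of the two slacks carries [f] and the other [g], so [tilde_uncross]
    applies on both classes and [rho_uncross] to the sizes. *)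
Lemma slack_uncross n f g X1 X2 Y1 Y2 :
  slackA n f g (X1 :|: X2) (Y1 :&: Y2) + slackB n f g (X1 :&: X2) (Y1 :|: Y2)
    + tilde (fun s => g (inl s) - f (inl s)) (X2 :\: X1)
    + tilde (fun t => g (inr t) - f (inr t)) (Y1 :\: Y2)
  <= slackA n f g X1 Y1 + slackB n f g X2 Y2.
Proof.
have uS := tilde_uncross (f \o inl) (g \o inl) X1 X2.
(* The two sets trade places because on [T] it is [slackA] that carries [f]. *)
have uT := tilde_uncross (f \o inr) (g \o inr) Y2 Y1.
have [cX1 cX2 cX] := cardsUI_diff X1 X2.
have [cY1 cY2 cY] := cardsUI_diff Y1 Y2.
have := rho_uncross n #|X1 :&: X2| #|Y1 :&: Y2| #|X1 :\: X2| #|X2 :\: X1|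
  #|Y1 :\: Y2| #|Y2 :\: Y1|.
rewrite -cX -cX1 -cX2 -cY -cY1 -cY2 /slackA /slackB.
rewrite [Y2 :&: Y1]setIC [Y2 :|: Y1]setUC /= in uT.
move: uS uT; rewrite /tilde /=; lia.
Qed.

Definition shift (V : eqType) (h : V -> int) (c : int) v u := h u + c * (u == v)%:Z.

Lemma tilde_shift_inl f c v X :
  tilde (shift f c v \o inl) X
  = tilde (f \o inl) X + c * (if v is inl s then s \in X else false)%:Z.
Proof.
rewrite !tildeE; under eq_bigr => s _ do rewrite /= mulrDr.
rewrite big_split /=; congr (_ + _).
case: v => [s|t]; last by rewrite big1 => [|s _]; rewrite !mulr0.
rewrite (bigD1 s) //= big1 => [|s' /negbTE ns]; first by rewrite eqxx addr0 mulr1 mulrC.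
by rewrite (_ : (inl s' == inl s :> S + T) = (s' == s)) // ns !mulr0.
Qed.

Lemma tilde_shift_inr f c v Y :
  tilde (shift f c v \o inr) Y
  = tilde (f \o inr) Y + c * (if v is inr t then t \in Y else false)%:Z.
Proof.
rewrite !tildeE; under eq_bigr => s _ do rewrite /= mulrDr.
rewrite big_split /=; congr (_ + _).
case: v => [s|t]; first by rewrite big1 => [|t _]; rewrite !mulr0.
rewrite (bigD1 t) //= big1 => [|t' /negbTE nt]; first by rewrite eqxx addr0 mulr1 mulrC.
by rewrite (_ : (inr t' == inr t :> S + T) = (t' == t)) // nt !mulr0.
Qed.

(** Boolean, so that its failure yields a violating pair. *)
Definition feasible n f g :=
  [forall X, forall Y, (0 <= slackA n f g X Y) && (0 <= slackB n f g X Y)].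

Lemma feasibleP n f g :
  reflect (forall X Y, 0 <= slackA n f g X Y /\ 0 <= slackB n f g X Y)
    (feasible n f g).
Proof.
apply: (iffP forallP) => [h X Y|h X]; first by have /forallP/(_ Y)/andP := h X.
by apply/forallP => Y; apply/andP.
Qed.

(** If both changes failed, integrality would give one tight pair for each condition, with [v] in
    the difference where uncrossing gains [g v - f v > 0]; the uncrossed slacks could not both be
    nonnegative. *)
Lemma feasible_step n f g v : (forall u, f u <= g u) -> f v < g v ->
  feasible n f g -> feasible n (shift f 1 v) g || feasible n f (shift g (-1) v).
Proof.
move=> lefg ltfg /feasibleP pos.
have geS s : 0 <= g (inl s) - f (inl s) by rewrite subr_ge0.
have geT t : 0 <= g (inr t) - f (inr t) by rewrite subr_ge0.
have absurd (U1 U2 : {set S}) (W1 W2 : {set T}) :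
    slackA n f g U1 W1 = 0 -> slackB n f g U2 W2 = 0 ->
    (match v with inl s => s \in U2 :\: U1 | inr t => t \in W1 :\: W2 end) ->
    False.
  move=> A0 B0 vD; have := slack_uncross n f g U1 U2 W1 W2.
  rewrite A0 B0.
  have [+ _] := pos (U1 :|: U2) (W1 :&: W2).
  have [_] := pos (U1 :&: U2) (W1 :|: W2).
  have := tilde_ge0 (U2 :\: U1) geS; have := tilde_ge0 (W1 :\: W2) geT.
  case: v ltfg vD => [s|t] ltfg vD.
    have := tilde_ge geS vD; lia.
  have := tilde_ge geT vD; lia.
apply/negPn/negP; rewrite negb_or => /andP[].
rewrite negb_forall => /existsP[X1]; rewrite negb_forall => /existsP[Y1 neg1].
rewrite negb_forall => /existsP[X2]; rewrite negb_forall => /existsP[Y2 neg2].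
have [A1 B1] := pos X1 Y1; have [A2 B2] := pos X2 Y2.
move: neg1 neg2; rewrite /slackA /slackB !tilde_shift_inl !tilde_shift_inr !negb_and -!ltNge.
rewrite /slackA in A1 A2; rewrite /slackB in B1 B2.
(* On [S], raising [f] hurts [slackB] and lowering [g] hurts [slackA]; on [T] it is the reverse.
   Hence the swapped arguments in the first case. *)
case: v ltfg absurd => [s|t] ltfg absurd neg1 neg2.
  apply: (absurd X2 X1 Y2 Y1); rewrite /slackA /slackB ?inE.
  - by move: neg2; rewrite ?inE; case: (s \in X2) => /=; lia.
  - by move: neg1; rewrite ?inE; case: (s \in X1) => /=; lia.
  - move: neg1 neg2; rewrite ?inE; case: (s \in X1); case: (s \in X2) => //=; lia.
apply: (absurd X1 X2 Y1 Y2); rewrite /slackA /slackB ?inE.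
- by move: neg1; rewrite ?inE; case: (t \in Y1) => /=; lia.
- by move: neg2; rewrite ?inE; case: (t \in Y2) => /=; lia.
- move: neg1 neg2; rewrite ?inE; case: (t \in Y1); case: (t \in Y2) => //=; lia.
Qed.

(** Induction on the total gap between [f] and [g], which each step lowers by one. *)
Lemma exact_degrees n f g : (forall v, f v <= g v) -> feasible n f g ->
  exists2 d, forall v, f v <= d v <= g v & feasible n d d.
Proof.
have [k] := ubnP `|(\sum_v (g v - f v))%R|%N.
elim: k => // k IHk in f g * => lek lefg feas.
have [/forallP eqfg|] := boolP [forall v, f v == g v].
  exists f => [v|]; first by rewrite lexx lefg.
  apply/feasibleP => X Y; move/feasibleP: feas => /(_ X Y).
  rewrite /slackA /slackB.
  have eS (Z : {set S}) : tilde (g \o inl) Z = tilde (f \o inl) Z.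
    by apply: eq_bigr => s _ /=; rewrite (eqP (eqfg _)).
  have eT (Z : {set T}) : tilde (g \o inr) Z = tilde (f \o inr) Z.
    by apply: eq_bigr => s _ /=; rewrite (eqP (eqfg _)).
  by rewrite eS eT.
rewrite negb_forall => /existsP[v nefg].
have ltfg : f v < g v by rewrite lt_neqAle nefg lefg.
have ge0 : 0 <= \sum_(u | u != v) (g u - f u).
  by apply: sumr_ge0 => u _; rewrite subr_ge0.
have sumE h1 h2 : (forall u, u != v -> h1 u = f u) ->
    (forall u, u != v -> h2 u = g u) ->
    \sum_u (h2 u - h1 u) = h2 v - h1 v + \sum_(u | u != v) (g u - f u).
  move=> e1 e2; rewrite (bigD1 v) //=; congr (_ + _).
  by apply: eq_bigr => u nuv; rewrite e1 ?e2.
rewrite (sumE f g) // in lek.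
have shiftN h c u : u != v -> shift h c v u = h u.
  by rewrite /shift => /negbTE->; rewrite mulr0 addr0.
have shiftv h c : shift h c v v = h v + c by rewrite /shift eqxx mulr1.
have /orP[] := feasible_step lefg ltfg feas => feas'.
  have [||d dP ?] := IHk _ _ _ _ feas'.
  - by rewrite (sumE (shift f 1 v) g) ?shiftv // => [|u]; [lia | apply: shiftN].
  - by move=> u; have [->|/shiftN->//] := eqVneq u v; rewrite shiftv; lia.
  exists d => // u; have := dP u.
  by have [->|/shiftN->//] := eqVneq u v; rewrite shiftv; lia.
have [||d dP ?] := IHk _ _ _ _ feas'.
- by rewrite (sumE f (shift g (-1) v)) ?shiftv // => [|u]; [lia | apply: shiftN].
- by move=> u; have [->|/shiftN->//] := eqVneq u v; rewrite shiftv; lia.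
exists d => // u; have := dP u.
by have [->|/shiftN->//] := eqVneq u v; rewrite shiftv; lia.
Qed.

(** * The reversed matching and graphs with exact degrees *)

Lemma antidiagonal_matching n d : (n <= #|S|)%N -> (n <= #|T|)%N ->
  exists M, [/\ is_matching M M, #|M| = n & forall a b,
    (edges M (~: above (d \o inl) a) (~: above (d \o inr) b)
      <= n - #|above (d \o inl) a| - #|above (d \o inr) b|)%N].
Proof.
move=> leS leT.
have [eS eS_inj eSP] := enum_decreasing (d \o inl).
have [eT eT_inj eTP] := enum_decreasing (d \o inr).
pose m (i : 'I_n) := (eS (widen_ord leS i), eT (widen_ord leT (rev_ord i))).
have m1_inj i j : (m i).1 = (m j).1 -> i = j.
  by move=> /eS_inj /(congr1 val) /= ij; apply: val_inj.
have m2_inj i j : (m i).2 = (m j).2 -> i = j.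
  move=> /eT_inj /(congr1 val) /= ij; apply: val_inj => /=.
  by have := ltn_ord i; have := ltn_ord j; lia.
have m_inj : injective m by move=> i j mij; apply: m1_inj; rewrite mij.
exists (m @: setT); split=> [||a b].
- rewrite /is_matching subxx; apply/forall_inP => _ /imsetP[i _ ->].
  apply/forall_inP => _ /imsetP[j _ ->]; apply/implyP.
  by case/orP=> /eqP => [/m1_inj|/m2_inj] ->.
- by rewrite card_imset // cardsT card_ord.
set X := above _ a; set Y := above _ b.
(* Level sets are initial segments, so [m i] avoids both exactly when [i] is in [I], an interval
   starting at [#|X|]; [n - i.+1] is the position of its end in [T]. *)
pose I := [set i : 'I_n | (#|X| <= i) && (#|Y| <= n - i.+1)]%N.
have -> : edges (m @: setT) (~: X) (~: Y) = #|I|.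
  rewrite -(card_imset (mem I) m_inj); apply: eq_card => e.
  rewrite !inE; apply/andP/imsetP => [[/imsetP[i _ ->]]|[i]].
    rewrite /= (eSP a) (eTP b) /= -!leqNgt => iI.
    by exists i; rewrite ?inE.
  rewrite inE => iI ->; split; first exact: imset_f.
  by rewrite /= (eSP a) (eTP b) /= -!leqNgt.
have uI : uniq [seq val i | i <- enum I] by rewrite (map_inj_uniq val_inj) enum_uniq.
have := @uniq_leq_size _ _ (iota #|X| (n - #|X| - #|Y|)) uI.
rewrite size_iota size_map -cardE; apply=> _ /mapP[i + ->].
by rewrite mem_enum inE mem_iota => /andP[]; have := ltn_ord i; rewrite /=; lia.
Qed.

(* For fixed Y the slack is least at X0, the set of s with d s > |Y|, since a
   matching edge changes the contribution of s by at most one; then, for X0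
   fixed, it is least at the set of t with d t > |X0|. *)
Lemma flow_slack_level n d M X Y : is_matching M M ->
  (forall X Y, 0 <= slackA n d d X Y) ->
  (forall a b,
    (edges M (~: above (d \o inl) a) (~: above (d \o inr) b)
      <= n - #|above (d \o inl) a| - #|above (d \o inr) b|)%N) ->
  0 <= flow_slack d M setT X Y.
Proof.
move=> mM posA levM.
pose X0 := above (d \o inl) #|Y|%:Z.
pose Y0 := above (d \o inr) #|X0|%:Z.
have step1 : flow_slack d M setT X0 Y <= flow_slack d M setT X Y.
  have E Z : flow_slack d M setT Z Y = - tilde (d \o inr) Y
      + \sum_s (if s \in Z then #|Y|%:Z
                else d (inl s) - (edges M [set s] (~: Y))%:Z).
    rewrite /flow_slack edges_setT PoszM -tilde_const edges_suml Posz_sum.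
    rewrite -[\sum_(s in ~: Z) _]/(tilde (fun s => (edges M [set s] (~: Y))%:Z) _).
    rewrite addrAC [RHS]addrC; congr (_ + _).
    rewrite !tildeE -sumrN -!big_split /=.
    by apply: eq_bigr => s _; rewrite !inE; case: (s \in Z) => /=; ring.
  rewrite !E lerD2l; apply: ler_sum => s _; rewrite in_above /=.
  have := matching1l s (~: Y) mM.
  by case: ltP; case: ifP; lia.
have step2 : flow_slack d M setT X0 Y0 <= flow_slack d M setT X0 Y.
  have E Z : flow_slack d M setT X0 Z = tilde (d \o inl) (~: X0)
      + \sum_t (if t \in Z then #|X0|%:Z - d (inr t)
                else - (edges M (~: X0) [set t])%:Z).
    rewrite /flow_slack edges_setT mulnC PoszM -tilde_const edges_sumr Posz_sum.
    rewrite -[\sum_(t in ~: Z) _]/(tilde (fun t => (edges M (~: X0) [set t])%:Z) _).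
    rewrite -!addrA; congr (_ + _); rewrite !tildeE -!sumrN -!big_split /=.
    by apply: eq_bigr => t _; rewrite !inE; case: (t \in Z) => /=; ring.
  rewrite !E lerD2l; apply: ler_sum => t _; rewrite in_above /=.
  have := matching1r (~: X0) t mM.
  by case: ltP; case: ifP; lia.
apply: le_trans step1; apply: le_trans step2.
(* At level sets the matching edges number at most the truncated term of [rho], so the flow slack is
   at least [slackA]. *)
have := posA X0 Y0; have := levM #|Y|%:Z #|X0|%:Z.
by rewrite /= -/X0 -/Y0 /flow_slack /slackA /rho edges_setT; lia.
Qed.

Lemma exact_graph n d : feasible n d d ->
  exists E, (n <= nu E)%N /\ forall v, (deg E v)%:Z = d v.
Proof.
(* The extreme pairs give [n <= #|S|], [n <= #|T|] and equal degree totals on the two sides. *)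
move=> /feasibleP feas.
have [A0 _] := feas setT set0; have [_ B0] := feas set0 setT.
have [A1 _] := feas set0 setT; have [_ B1] := feas setT set0.
move: A0 B0 A1 B1; rewrite /slackA /slackB /rho !setC0 !setCT !cards0 !cardsT !tilde0.
rewrite muln0 mul0n => A0 B0 A1 B1.
have leS : (n <= #|S|)%N by lia.
have leT : (n <= #|T|)%N by lia.
have [M [mM cM levM]] := antidiagonal_matching d leS leT.
have posA X Y : 0 <= slackA n d d X Y by have [] := feas X Y.
(* Lower bound [M] and the complete graph as upper bound: the graph found contains [M]. *)
have [E sME posE] :=
  flow_exists (subsetT M) (fun X Y => flow_slack_level X Y mM posA levM).
exists E; split.
  rewrite -cM; apply: (bigop.bigmax_sup M) => //.
  by case/andP: mM => _ mM; rewrite /is_matching sME.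
by apply: flow_slack_deg posE; lia.
Qed.

Lemma graph_AB_exists l f g : (forall v, f v <= g v) ->
  (forall X Y, ineq1 l f g X Y) -> (forall X Y, ineq2 l f g X Y) ->
  exists E, graph_AB l f g E.
Proof.
move=> lefg i1 i2.
have [|d dP /exact_graph[E [nuE degE]]] := @exact_degrees `|Num.max l 0| f g lefg.
  by apply/feasibleP => X Y; split; [apply/ineq1E | apply/ineq2E].
exists E; split=> [|v]; first by lia.
by rewrite degE.
Qed.

(** * Necessity of the two conditions *)

Lemma sum_deg_inl E X : (\sum_(s in X) deg E (inl s))%N = edges E X setT.
Proof. by rewrite edges_suml; apply: eq_bigr => s _; rewrite deg_inlE. Qed.

Lemma sum_deg_inr E Y : (\sum_(t in Y) deg E (inr t))%N = edges E setT Y.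
Proof. by rewrite edges_sumr; apply: eq_bigr => t _; rewrite deg_inrE. Qed.

Lemma nu_cover E X Y : (nu E <= #|X| + #|Y| + edges E (~: X) (~: Y))%N.
Proof.
have [M mM <-] := nu_attained E; apply: leq_trans (matching_cover X Y mM) _.
by rewrite leq_add2l; apply: edges_subset; case/andP: mM.
Qed.

(** At most [#|X| * #|Y|] edges at [Y] come from [X]; the rest start in [~: X], and so do the at
    least [l - #|X| - #|Y|] edges joining [~: X] to [~: Y]. *)
Lemma graph_A_ineq1 l f g E X Y : graph_A l f g E -> ineq1 l f g X Y.
Proof.
move=> [nuE degS degT].
have hS : (edges E (~: X) setT)%:Z <= tilde (g \o inl) (~: X).
  by rewrite -sum_deg_inl Posz_sum; apply: ler_sum => s _; apply: degS.
have hT : tilde (f \o inr) Y <= (edges E setT Y)%:Z.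
  by rewrite -sum_deg_inr Posz_sum; apply: ler_sum => t _; apply: degT.
have := nu_cover E X Y; have := edges_le E X Y.
rewrite (edges_splitr _ _ Y) in hS; rewrite (edges_splitl _ X) in hT.
rewrite /ineq1 /pos_part -PoszM; lia.
Qed.

Lemma graph_B_ineq2 l f g E X Y : graph_B l f g E -> ineq2 l f g X Y.
Proof.
move=> [nuE degS degT].
have hT : (edges E setT (~: Y))%:Z <= tilde (g \o inr) (~: Y).
  by rewrite -sum_deg_inr Posz_sum; apply: ler_sum => t _; apply: degT.
have hS : tilde (f \o inl) X <= (edges E X setT)%:Z.
  by rewrite -sum_deg_inl Posz_sum; apply: ler_sum => s _; apply: degS.
have := nu_cover E X Y; have := edges_le E X Y.
rewrite (edges_splitl _ X) in hT; rewrite (edges_splitr _ _ Y) in hS.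
rewrite /ineq2 /pos_part -PoszM; lia.
Qed.

(** * Restriction to sets of largest values *)

(** With the sizes fixed, larger values in [Y] raise the left side and larger values in [X] lower
    the weight of [~: X], so the largest sets are the worst case. *)
Lemma ineq1_largest l f g :
  (forall i j, (i <= #|S|)%N -> (j <= #|T|)%N -> forall X Y,
     largest (g \o inl) i X -> largest (f \o inr) j Y -> ineq1 l f g X Y) ->
  forall X Y, ineq1 l f g X Y.
Proof.
move=> top X Y.
have [X' [lX' cX' leX']] := largest_exists (g \o inl) X.
have [Y' [lY' cY' leY']] := largest_exists (f \o inr) Y.
have := top _ _ (max_card _) (max_card _) _ _ lX' lY'.
by rewrite /ineq1 !tildeC cX' cY'; lia.
Qed.

Lemma ineq2_largest l f g :
  (forall i j, (i <= #|S|)%N -> (j <= #|T|)%N -> forall X Y,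
     largest (f \o inl) i X -> largest (g \o inr) j Y -> ineq2 l f g X Y) ->
  forall X Y, ineq2 l f g X Y.
Proof.
move=> top X Y.
have [X' [lX' cX' leX']] := largest_exists (f \o inl) X.
have [Y' [lY' cY' leY']] := largest_exists (g \o inr) Y.
have := top _ _ (max_card _) (max_card _) _ _ lX' lY'.
by rewrite /ineq2 !tildeC cX' cY'; lia.
Qed.

(** * Sufficiency of each condition by itself *)

Lemma graph_A_exists l f g : l <= #|T|%:Z -> (forall v, 0 <= g v) ->
  (forall X Y, ineq1 l f g X Y) -> exists E, graph_A l f g E.
Proof.
move=> hl g0 i1.
pose f' v : int := match v with inl _ => 0 | inr _ => f v end.
(* With values at least 1 on [T], [~: Y] weighs at least [#|T| - #|Y|], which covers the truncated
   term since [l <= #|T|]. *)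
pose g' v : int := match v with inl _ => g v | inr _ => Num.max (f v) 0 + 1 end.
have [||X Y|E [nuE degE]] := @graph_AB_exists l f' g'.
- by move=> [s|t] /=; [apply: g0 | lia].
- exact: i1.
- have f'0 : tilde (f' \o inl) X = 0 by apply: big1.
  have : #|~: Y|%:Z <= tilde (g' \o inr) (~: Y).
    by rewrite -[#|_|%:Z]mulr1 -tilde_const; apply: ler_sum => t _ /=; lia.
  rewrite /ineq2 f'0 /pos_part -PoszM; move: (muln _ _) (cardsC Y); lia.
exists E; split=> // [s|t]; first by have /andP[] := degE (inl s).
by have /andP[] := degE (inr t).
Qed.

(** Mirror image: the relaxed upper bound now sits on [S], and [l <= #|S|] covers the truncated
    term. *)
Lemma graph_B_exists l f g : l <= #|S|%:Z -> (forall v, 0 <= g v) ->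
  (forall X Y, ineq2 l f g X Y) -> exists E, graph_B l f g E.
Proof.
move=> hl g0 i2.
pose f' v : int := match v with inl _ => f v | inr _ => 0 end.
pose g' v : int := match v with inl _ => Num.max (f v) 0 + 1 | inr _ => g v end.
have [|X Y||E [nuE degE]] := @graph_AB_exists l f' g'.
- by move=> [s|t] /=; [lia | apply: g0].
- have f'0 : tilde (f' \o inr) Y = 0 by apply: big1.
  have : #|~: X|%:Z <= tilde (g' \o inl) (~: X).
    by rewrite -[#|_|%:Z]mulr1 -tilde_const; apply: ler_sum => t _ /=; lia.
  rewrite /ineq1 f'0 /pos_part -PoszM; move: (muln _ _) (cardsC X); lia.
- exact: i2.
exists E; split=> // [s|t]; first by have /andP[] := degE (inl s).
by have /andP[] := degE (inr t).
Qed.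

End Edges.

(** * The equivalences for (A), (B) and (AB) *)

Theorem theorem27 (S T : finType) (l : int) (f g : S + T -> int)
    (hl : l <= #|T|%:Z) (hfg : forall v : S + T, 0 <= f v <= g v) :
  (* (A) *)
  (((exists E' : {set S * T}, graph_A l f g E') <->
      (forall (X : {set S}) (Y : {set T}), ineq1 l f g X Y)) /\
   ((forall i j : nat, (i <= #|S|)%N -> (j <= #|T|)%N ->
       forall (X : {set S}) (Y : {set T}),
         largest (g \o inl) i X -> largest (f \o inr) j Y ->
         ineq1 l f g X Y) ->
      forall (X : {set S}) (Y : {set T}), ineq1 l f g X Y)) /\
  (* (B); the bound l <= #|S| is needed for sufficiency only *)
  (((exists E'' : {set S * T}, graph_B l f g E'') ->
      (forall (X : {set S}) (Y : {set T}), ineq2 l f g X Y)) /\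
   (l <= #|S|%:Z ->
      (forall (X : {set S}) (Y : {set T}), ineq2 l f g X Y) ->
      exists E'' : {set S * T}, graph_B l f g E'') /\
   ((forall i j : nat, (i <= #|S|)%N -> (j <= #|T|)%N ->
       forall (X : {set S}) (Y : {set T}),
         largest (f \o inl) i X -> largest (g \o inr) j Y ->
         ineq2 l f g X Y) ->
      forall (X : {set S}) (Y : {set T}), ineq2 l f g X Y)) /\
  (* (AB) *)
  (((exists E : {set S * T}, graph_AB l f g E) <->
      (exists E' : {set S * T}, graph_A l f g E') /\
      (exists E'' : {set S * T}, graph_B l f g E'')) /\
   ((exists E : {set S * T}, graph_AB l f g E) <->
      (forall (X : {set S}) (Y : {set T}), ineq1 l f g X Y) /\
      (forall (X : {set S}) (Y : {set T}), ineq2 l f g X Y))).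
Proof.
have lefg v : f v <= g v by have /andP[] := hfg v.
have g0 v : 0 <= g v by have /andP[f0 fg] := hfg v; apply: le_trans fg.
have AB_of : (forall X Y, ineq1 l f g X Y) -> (forall X Y, ineq2 l f g X Y) ->
    exists E, graph_AB l f g E by exact: graph_AB_exists.
have A_of_AB E : graph_AB l f g E -> graph_A l f g E.
  by move=> [nuE degE]; split=> // [s|t];
    [have /andP[] := degE (inl s) | have /andP[] := degE (inr t)].
have B_of_AB E : graph_AB l f g E -> graph_B l f g E.
  by move=> [nuE degE]; split=> // [s|t];
    [have /andP[] := degE (inl s) | have /andP[] := degE (inr t)].
split; [split|split; [split; [|split]|split]].
- split=> [[E AE] X Y|]; first exact: graph_A_ineq1 AE.
  exact: graph_A_exists.
- exact: ineq1_largest.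
- by move=> [E BE] X Y; apply: graph_B_ineq2 BE.
- by move=> lS; apply: graph_B_exists.
- exact: ineq2_largest.
- split=> [[E ABE]|[[E1 AE] [E2 BE]]].
    by split; exists E; [apply: A_of_AB | apply: B_of_AB].
  (* The two graphs are used only through the inequalities that they imply. *)
  by apply: AB_of => X Y; [apply: graph_A_ineq1 AE | apply: graph_B_ineq2 BE].
- split=> [[E ABE]|[i1 i2]]; last exact: AB_of.
  by split=> X Y; [apply/graph_A_ineq1/A_of_AB/ABE | apply/graph_B_ineq2/B_of_AB/ABE].
Qed.
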